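(* Let $f\in\omega^\omega$ and $\mathcal G=\{h_n:n<\omega\}\subseteq\omega^\omega$ be as described in the context. Then any Boolean algebra with a strictly positive probability finitely additive measure is $\mathbf R^f_{\mathcal G}$-good.
   Context: A strictly positive probability finitely additive measure on a Boolean algebra $\mathbb A$ is $\mu\colon\mathbb A\to[0,1]$ with $\mu(\mathbf 1)=1$, $\mu(a\vee a')=\mu(a)+\mu(a')$ whenever $a\wedge a'=\mathbf 0$, and $\mu(a)=0$ iff $a=\mathbf 0$. A Boolean algebra $\mathbb A$ is regarded as the forcing notion $\mathbb A\setminus\{\mathbf 0\}$. ''Increasing'' means strictly increasing. The system $\mathbf R^f_{\mathcal G}$. $f\in\omega^\omega$ is increasing with $f>0$, $f(-1):=0$, and $\mathcal G=\{h_n:n<\omega\}$ is a family of increasing functions in $\omega^\omega$ such that for all $n,i<\omega$: (i) $2^{i+1}h_n(i)\le h_{n+1}(i)$, and (ii) if $i\ge n$ then $h_n(i)<2^{f(i)-f(i-1)}$. (When used as a set, $2^{f(i)}$ is the set of binary sequences of length $f(i)$.) $\mathcal S_f(\mathcal G)$ is the set of all functions $\psi$ with domain $\omega$ such that for some $g\in\mathcal G$, for all $i$: $\psi(i)\subseteq 2^{f(i)}$ and $|\psi(i)|\le g(i)$, and moreover $|\psi(i)|<2^{f(i)-f(i-1)}$ for all $i$. For $t\in\bigcup_{i<\omega}2^{f(i)}$, $\sigma\in(2^{<\omega})^\omega$ and $\psi\in\mathcal S_f(\mathcal G)$, $(t,\sigma)\sqsubset^f\psi$ iff for all but finitely many $n$: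 if $\sigma(n)\supseteq t$ then there is $k<\omega$ with $|t|<f(k)\le|\sigma(n)|$ and $\sigma(n){\upharpoonright}f(k)\in\psi(k)$. $\mathbf R^f_{\mathcal G}:=\langle \bigcup_{i<\omega}2^{f(i)}\times(2^{<\omega})^\omega,\ \mathcal S_f(\mathcal G),\ \sqsubset^f\rangle$. Goodness. For $\mathbf R=\langle X,Y,\sqsubset\rangle=\mathbf R^f_{\mathcal G}$, a poset $\mathbb P$ is $\mathbf R$-good if for any $\mathbb P$-name $\dot h$ for a member of $Y$ there is a non-empty countable set $H\subseteq Y$ in the ground model such that, for any $x\in X$ (in the ground model), if $\neg(x\sqsubset y)$ for all $y\in H$, then $\Vdash_{\mathbb P}\neg(x\sqsubset\dot h)$. *)

(* Defs.v *)
From HB Require Import structures.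
From mathcomp Require Import all_boot all_order all_algebra.
From mathcomp Require Import boolp classical_sets functions cardinality reals.
Set Implicit Arguments.
Unset Strict Implicit.
Unset Printing Implicit Defensive.
Import Order.TTheory GRing.Theory Num.Theory.
Local Open Scope nat_scope.

Definition strictly_positive_fam (R : realType) (d : Order.disp_t)
    (A : ctbDistrLatticeType d) (mu : A -> R) : Prop :=
  [/\ forall a : A, (0 <= mu a <= 1)%R,
      mu (\top)%O = 1%R,
      forall a b : A, (a `&` b)%O = (\bot)%O -> mu (a `|` b)%O = (mu a + mu b)%R &
      forall a : A, mu a = 0%R <-> a = (\bot)%O].

(* [A] as a forcing notion: its nonzero elements with the order of [A]. *)
Definition nonzero (d : Order.disp_t) (A : ctbDistrLatticeType d) : Type :=
  {a : A | a != (\bot)%O}.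
#[warnings="-redundant-canonical-projection,-projection-no-head-constant"]
HB.instance Definition _ (d : Order.disp_t) (A : ctbDistrLatticeType d) :=
  SubChoice.on (nonzero A).
#[warnings="-redundant-canonical-projection"]
HB.instance Definition _ (d : Order.disp_t) (A : ctbDistrLatticeType d) :=
  [SubChoice_isSubPOrder of nonzero A by <: with d].

(* Sets of the ground model, as well-founded trees: [@VSet T u] is {u i | i : T}. *)
Inductive V : Type := VSet (T : Type) of T -> V.

Definition vupair (x y : V) : V := VSet (fun b : bool => if b then x else y).

Definition vpair (x y : V) : V := vupair (vupair x x) (vupair x y).

(* The von Neumann successor: x together with the extra element x. *)
Definition vsucc (x : V) : V :=
  let: VSet T u := x in VSet (fun o : option T => if o is Some i then u i else x).

Definition vnat (n : nat) : V := iter n vsucc (VSet (fun e : False => match e with end)).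

(* A finite binary sequence is a function from its length to 2. *)
Definition vseq (s : seq bool) : V :=
  VSet (fun i : 'I_(size s) => vpair (vnat i) (vnat (nth false s i))).

Definition vsetseq (m : nat) (S : {set m.-tuple bool}) : V :=
  VSet (fun s : {s : m.-tuple bool | s \in S} => vseq (val s)).

Section Forcing.
Variables (d : Order.disp_t) (P : porderType d).
Implicit Types (p q r : P).

(* [Name u c] is the P-name {(u i, c i) | i : T}. *)
Inductive name : Type := Name (T : Type) of (T -> name) & (T -> P).

(* [P] need not have a largest element, so check names use all conditions. *)
Fixpoint check (x : V) : name :=
  let: VSet T u := x in
  Name (fun ip : T * P => check (u ip.1)) (fun ip : T * P => ip.2).

(* A sentence of the forcing language is identified with the predicate
   "p forces it" on conditions.  [fimp] agrees with the usual clause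
   "no q <= p forces F and the negation of G" whenever [G] is forced as soon
   as it is forced densely, which holds for every consequent used below. *)
Definition fprop := P -> Prop.

Definition dense_below (D : P -> Prop) : fprop :=
  fun p => forall q, (q <= p)%O -> exists2 r, (r <= q)%O & D r.

Fixpoint feq (x y : name) (p : P) {struct x} : Prop :=
  let: Name T u c := x in
  let: Name U v e := y in
  (forall i q, (q <= p)%O -> (q <= c i)%O ->
     dense_below (fun r => exists2 j, (r <= e j)%O & feq (u i) (v j) r) q) /\
  (forall j q, (q <= p)%O -> (q <= e j)%O ->
     dense_below (fun r => exists2 i, (r <= c i)%O & feq (u i) (v j) r) q).

Definition fmem (x y : name) : fprop :=
  let: Name U v e := y in
  dense_below (fun r => exists2 j, (r <= e j)%O & feq x (v j) r).

(* [fpure Q]: a statement [Q] about ground-model objects that is absolute. *)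
Definition fpure (Q : Prop) : fprop := fun=> Q.
Definition fand (F G : fprop) : fprop := fun p => F p /\ G p.
Definition fnot (F : fprop) : fprop := fun p => forall q, (q <= p)%O -> ~ F q.
Definition fimp (F G : fprop) : fprop :=
  fun p => forall q, (q <= p)%O -> F q -> G q.
Definition fall (T : Type) (F : T -> fprop) : fprop := fun p => forall x, F x p.
Definition fex (T : Type) (F : T -> fprop) : fprop :=
  dense_below (fun r => exists x, F x r).

Definition forced (F : fprop) : Prop := forall p, F p.

End Forcing.

(* f i - f (i - 1), with the convention f (-1) = 0. *)
Definition gap (f : nat -> nat) (i : nat) : nat :=
  if i is j.+1 then f i - f j else f i.

Definition increasing (f : nat -> nat) : Prop := {homo f : i j / i < j}.

Definition admissible (f : nat -> nat) (h : nat -> nat -> nat) : Prop :=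
  [/\ increasing f, forall i, 0 < f i, forall n, increasing (h n),
      forall n i, 2 ^ i.+1 * h n i <= h n.+1 i &
      forall n i, n <= i -> h n i < 2 ^ gap f i].

Section System.
Variables (f : nat -> nat) (h : nat -> nat -> nat).

Definition slalom : Type := forall i : nat, {set (f i).-tuple bool}.

Definition SfG : set slalom :=
  [set psi : slalom | (exists n, forall i, #|psi i| <= h n i) /\
             (forall i, #|psi i| < 2 ^ gap f i)]%classic.

Definition Xf : set (seq bool * (nat -> seq bool)) :=
  [set x | exists i, size x.1 = f i]%classic.

Definition seq_in (k : nat) (s : seq bool) (S : {set (f k).-tuple bool}) : Prop :=
  exists2 u, u \in S & tval u = s.

Definition sqsub (x : seq bool * (nat -> seq bool)) (psi : slalom) : Prop :=
  exists N, forall n, N <= n -> prefix x.1 (x.2 n) ->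
    exists k, size x.1 < f k <= size (x.2 n) /\
              seq_in (take (f k) (x.2 n)) (psi k).

(* The same notions for a P-name [tau] in the generic extension.  Natural
   numbers, finite binary sequences and sets of binary sequences of a fixed
   finite length are the same in the ground model and in the extension, so
   quantifiers over them range over ground-model objects. *)
Section Extension.
Variables (d : Order.disp_t) (P : porderType d).

(* [(i, S)] belongs to [tau], i.e., [tau(i) = S] if [tau] is a function. *)
Definition fgraph_at (tau : name P) (i : nat) (S : {set (f i).-tuple bool}) : fprop P :=
  fmem (check P (vpair (vnat i) (vsetseq S))) tau.

(* [tau] is a function with domain [nat] and [tau(i)] a subset of 2^(f i). *)
Definition fslalom (tau : name P) : fprop P :=
  fand
    (fall (fun z : name P => fimp (fmem z tau)
      (fex (fun i => fex (fun S : {set (f i).-tuple bool} =>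
         feq z (check P (vpair (vnat i) (vsetseq S))))))))
  (fand
    (fall (fun i => fex (fun S => @fgraph_at tau i S)))
    (fall (fun i => fall (fun S => fall (fun S' =>
       fimp (fand (@fgraph_at tau i S) (@fgraph_at tau i S'))
            (fpure (S = S'))))))).

Definition fSfG (tau : name P) : fprop P :=
  fand (fslalom tau)
  (fand
    (fex (fun n => fall (fun i => fall (fun S =>
       fimp (@fgraph_at tau i S) (fpure (#|S| <= h n i))))))
    (fall (fun i => fall (fun S =>
       fimp (@fgraph_at tau i S) (fpure (#|S| < 2 ^ gap f i)))))).

Definition fsqsub (x : seq bool * (nat -> seq bool)) (tau : name P) : fprop P :=
  fex (fun N => fall (fun n =>
    fimp (fpure (N <= n)) (fimp (fpure (prefix x.1 (x.2 n)))
      (fex (fun k => fand (fpure (size x.1 < f k <= size (x.2 n)))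
        (fex (fun S => fand (@fgraph_at tau k S)
                            (fpure (seq_in (take (f k) (x.2 n)) S))))))))).

Definition good : Prop :=
  forall tau : name P, forced (fSfG tau) ->
  exists H : set slalom,
    [/\ (H !=set0)%classic, countable H, (H `<=` SfG)%classic &
        forall x, Xf x -> (forall psi, H psi -> ~ sqsub x psi) ->
          forced (fnot (fsqsub x tau))].

End Extension.
End System.

(* Main.v *)
Require Import Defs.
From mathcomp Require Import all_boot all_order all_algebra.
From mathcomp Require Import boolp classical_sets reals.
From mathcomp Require Import cardinality filter.
From mathcomp Require Import ring lra.

(** Why the theorem holds.  A pattern of length [L] is a sequence of candidate
    values for [tau(0), ..., tau(L-1)], and a condition allows a pattern if
    some stronger condition forces it to be an initial segment of [tau].

    The measure [mu] is transferred to a probability [nu L] on the finite set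
    of patterns of length [L] in such a way that the patterns allowed by [a]
    have probability at least [mu a] ([fam_transfer]).  The algebra need not be
    complete, so Boolean values of statements about [tau] may be missing; but
    the inner measure [Y |-> sup {mu a : a allows only patterns in Y}] is
    supermodular, hence a convex game, and such a game has an additive majorant
    in its core ([convex_game_core]).

    Suppose that the sets in [tau] are forced to have size at most [h n i].
    Put [M = n + m + 1] and fix a pattern [u] of length [M] within the bounds.
    Conditionally on [tau] beginning with [u], keep at each coordinate [i >= M] the sequences
    whose probability of lying in [tau(i)] exceeds [2 ^ -((i+1)(m+1))].  By
    Markov's inequality there are at most [2 ^ ((i+1)(m+1)) * h n i] of them,
    which is at most [h M i] by the growth of [h], and [h M i < 2 ^ gap f i]
    because [i >= M].  Below [M] this last inequality is not available, and
    there [u] itself is used.  This gives a slalom that obeys the bounds below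
    [L]; an ultrafilter limit over [L] obeys them everywhere, and is the slalom
    [psi n m u].  The countable set [H] consists of these slaloms, together with the empty one.

    Finally, let [x = (t, sigma)] be bounded by no member of [H], and suppose
    that a condition [a], deciding [n] and a threshold [N] for [sigma], forces
    [x] to be bounded by [tau].  Choose [m] with [2 ^ -m < mu a].  For each [u]
    some [sigma(l)] with [l >= N] extends [t] and escapes [psi n m u].  Every
    pattern that [a] allows and that begins with [u] must capture that
    [sigma(l)], necessarily at a coordinate [k >= M]; this has conditional
    probability at most [2 ^ -((k+1)(m+1))].  Summing over [k], and averaging
    over [u], gives [mu a <= 2 ^ -m] ([capture_bound]), a contradiction.  Only
    finitely many [u] and [k] are involved, so one large [L] serves them all. *)
Set Implicit Arguments.
Unset Strict Implicit.
Unset Printing Implicit Defensive.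
Import Order.Theory GRing.Theory Num.Theory.
Local Open Scope ring_scope.

(** * From a finitely additive measure to a finite probability space *)

Section ConvexGame.
Variables (R : realType) (Omega : finType) (v : {set Omega} -> R).
Hypothesis v_empty : v finset.set0 = 0.
Hypothesis v_mono : forall Y Z : {set Omega}, Y \subset Z -> v Y <= v Z.
Hypothesis v_supermod :
  forall Y Z : {set Omega}, v Y + v Z <= v (Y :|: Z) + v (Y :&: Z).

(** Shapley's theorem that a convex game has a nonempty core.  The greedy
    vector, paying each point its marginal contribution in a fixed enumeration,
    works: by supermodularity a point contributes at least as much to an
    initial segment of the enumeration as to any subset of that segment. *)
Lemma convex_game_core : exists nu : Omega -> R,
  [/\ forall w, 0 <= nu w,
      \sum_w nu w = v [set: Omega]%SET &
      forall Y : {set Omega}, v Y <= \sum_(w in Y) nu w].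
Proof.
pose P j := [set w : Omega | (enum_rank w < j)%N]%SET.
have PS w : P (enum_rank w).+1 = (w |: P (enum_rank w))%SET.
  apply/setP => w'; rewrite !inE ltnS leq_eqVlt.
  by rewrite (inj_eq val_inj) (inj_eq enum_rank_inj).
have PN w : w \notin P (enum_rank w) by rewrite inE ltnn.
have Pfull : P #|Omega| = [set: Omega]%SET.
  by apply/setP => w; rewrite !inE ltn_ord.
have P0 : P 0%N = finset.set0 by apply/setP => w; rewrite !inE.
pose nu (w : Omega) := v (P (enum_rank w).+1) - v (P (enum_rank w)).
have stepE (j : nat) : (j < #|Omega|)%N -> exists w : Omega, enum_rank w = j :> nat.
  by move=> lj; exists (enum_val (Ordinal lj)); rewrite enum_valK.
exists nu; split.
- by move=> w; rewrite subr_ge0 v_mono// PS finset.subsetUr.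
- have H (j : nat) : (j <= #|Omega|)%N -> \sum_(w in P j) nu w = v (P j).
    elim: j => [|j IH] lj; first by rewrite P0 big_set0 v_empty.
    have [w wj] := stepE _ lj.
    have {}IH := IH (ltnW lj); rewrite -wj in IH *.
    by rewrite {1}PS big_setU1 ?PN//= IH /nu; ring.
  by rewrite -Pfull -H// Pfull; apply: eq_bigl => w; rewrite inE.
- move=> Y.
  have H (j : nat) : (j <= #|Omega|)%N ->
      v (Y :&: P j) <= \sum_(w in Y :&: P j) nu w.
    elim: j => [|j IH] lj; first by rewrite P0 finset.setI0 big_set0 v_empty.
    have [w wj] := stepE _ lj.
    have {}IH := IH (ltnW lj).
    rewrite -wj PS finset.setIUr; rewrite -wj in IH.
    have [wY|wY] := boolP (w \in Y); last first.
      by rewrite (_ : Y :&: [set w] = finset.set0)%SET ?finset.set0U//;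
        apply/setP => w'; rewrite !inE; case: eqP => [->|]; rewrite ?andbF// (negbTE wY).
    rewrite (_ : Y :&: [set w] = [set w])%SET; last first.
      by apply/setP => w'; rewrite !inE; case: eqP => [->|]; rewrite ?andbF// wY.
    rewrite big_setU1 ?inE ?ltnn ?andbF//=.
    have := v_supermod (w |: Y :&: P (enum_rank w))%SET (P (enum_rank w)).
    rewrite (_ : (w |: Y :&: P _) :|: P _ = P (enum_rank w).+1)%SET; last first.
      rewrite PS -finset.setUA; congr (_ :|: _)%SET.
      by apply/finset.setUidPr/finset.subsetIr.
    rewrite (_ : (w |: Y :&: P _) :&: P _ = Y :&: P (enum_rank w))%SET; last first.
      apply/setP => w'; rewrite !inE; case: eqP => [->|_] /=; first by rewrite ltnn andbF.
      by rewrite -andbA andbb.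
    rewrite /nu; lra.
  by have := H _ (leqnn _); rewrite Pfull finset.setIT.
Qed.
End ConvexGame.

Section Measure.
Variables (R : realType) (d : Order.disp_t) (A : ctbDistrLatticeType d).
Variable mu : A -> R.
Hypothesis hmu : strictly_positive_fam mu.

Lemma fam_bot : mu \bot%O = 0.
Proof. by case: hmu => _ _ _ /(_ \bot%O) [_ ->]. Qed.

Lemma fam_ge0 a : 0 <= mu a.
Proof. by case: hmu => /(_ a)/andP[]. Qed.

Lemma fam_le1 a : mu a <= 1.
Proof. by case: hmu => /(_ a)/andP[]. Qed.

Lemma fam_diff a b : mu a = mu (a `&` b)%O + mu (a `\` b)%O.
Proof.
case: hmu => _ _ add _; rewrite -add ?joinIB//.
exact: meetIB.
Qed.

Lemma fam_modular a b : mu (a `|` b)%O + mu (a `&` b)%O = mu a + mu b.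
Proof.
have := fam_diff (a `|` b)%O b; have := fam_diff a b.
rewrite (meet_r (leUr b a)) joinBK.
by move=> -> ->; ring.
Qed.

Lemma fam_mono a b : (a <= b)%O -> mu a <= mu b.
Proof.
move=> ab; rewrite (fam_diff b a) (meet_r ab) lerDl; exact: fam_ge0.
Qed.

(** The point is that [T] need not commute with meets: only the inner measure
    [Y |-> sup {mu a : T a \subset Y}] is available on sets [Y], and it is
    supermodular because joins go to unions, meets go into intersections and
    [mu] is modular.  A core element of this game is the required [nu]. *)
Lemma fam_transfer (Omega : finType) (T : A -> {set Omega}) :
    (forall a b, (a <= b)%O -> T a \subset T b) ->
    (forall a b, T (a `|` b)%O \subset (T a :|: T b)%SET) ->
    (forall a, T a = finset.set0 <-> a = \bot%O) ->
  exists nu : Omega -> R,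
    [/\ forall w, 0 <= nu w, \sum_w nu w <= 1 &
        forall a, mu a <= \sum_(w in T a) nu w].
Proof.
move=> T_mono T_join T_null.
pose values (Y : {set Omega}) := [set mu a | a in [set a | T a \subset Y]]%classic.
have T_bot : T \bot%O = finset.set0 by apply/T_null.
have values0 Y : (values Y !=set0)%classic.
  by exists (mu \bot%O); exists \bot%O; rewrite //= T_bot finset.sub0set.
have le_sup (Y : {set Omega}) a : T a \subset Y -> mu a <= sup (values Y).
  move=> aY; apply: ub_le_sup; last by exists a.
  by exists 1 => _ [b _ <-]; exact: fam_le1.
have sup_le (Y : {set Omega}) c : (forall a, T a \subset Y -> mu a <= c) -> sup (values Y) <= c.
  by move=> H; apply: ge_sup => // _ [a aY <-]; exact: H.
have [|Y Z YZ|Y Z|nu [nu0 nu1 nuT]] := @convex_game_core R Omega (fun Y => sup (values Y)).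
- apply/le_anti/andP; split=> /=.
    apply/sup_le => a; rewrite finset.subset0 => /eqP/T_null ->.
    by rewrite fam_bot.
  by rewrite -fam_bot; apply/le_sup; rewrite T_bot.
- by apply/sup_le => /= a aY; apply/le_sup; apply: fintype.subset_trans YZ.
- rewrite /= -lerBrDr; apply/sup_le => a aY; rewrite lerBrDr -lerBrDl.
  apply/sup_le => b bZ; rewrite lerBrDl -fam_modular.
  apply: lerD; apply/le_sup.
    by apply: fintype.subset_trans (T_join a b) _; apply: finset.setUSS.
  rewrite finset.subsetI (fintype.subset_trans _ aY) ?(fintype.subset_trans _ bZ)//.
    exact/T_mono/leIr.
  exact/T_mono/leIl.
- exists nu; split => //; first by rewrite nu1; apply/sup_le => a _; exact: fam_le1.
  by move=> a; apply: le_trans (nuT _); apply/le_sup.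
Qed.
End Measure.

(** * Counting, growth and limits *)

Lemma ultrafilter_limit (F : set_system nat) (X : finType) (x : nat -> X) :
  UltraFilter F -> exists y, F [set L | x L = y]%classic.
Proof.
move=> FU; apply: contrapT => /forallNP H.
have : F [set L | forall y, (~` [set L | x L = y])%classic L]%classic.
  apply: filter_forall => y.
  by have [|//] := in_ultra_setVsetC [set L | x L = y]%classic FU => /H.
by move=> /filter_ex[L /(_ (x L))]; apply.
Qed.

(** Markov's inequality for the conditional distribution of the random set
    [S] given [B].  The strict inequality in the selected set makes that set
    empty when [B] has probability [0]. *)
Lemma markov_selection (R : realType) (Omega X : finType) (nu : Omega -> R)
    (B : pred Omega) (S : Omega -> {set X}) (c : nat) (e : R) :
    (forall w, 0 <= nu w) -> (forall w, B w -> #|S w| <= c)%N -> 0 < e ->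
  e * #|[set s | e * (\sum_(w | B w) nu w) < \sum_(w | B w && (s \in S w)) nu w]%SET|%:R
    <= c%:R.
Proof.
move=> nu0 Sc e0; set b := \sum_(w | B w) nu w; set Z := [set s | _]%SET.
have b0 : 0 <= b by apply: sumr_ge0.
have sumE : \sum_s \sum_(w | B w && (s \in S w)) nu w <= c%:R * b.
  rewrite (exchange_big_dep B) => [|s w _ /andP[]//] /=.
  rewrite mulr_sumr; apply: ler_sum => w Bw.
  under eq_bigl do rewrite Bw.
  by rewrite sumr_const -[leLHS]mulr_natl ler_wpM2r// ler_nat; apply: Sc.
have ZE : e * #|Z|%:R * b <= c%:R * b.
  apply: le_trans sumE; rewrite (bigID (mem Z)) /= ler_wpDr//.
    by apply: sumr_ge0 => s _; apply: sumr_ge0.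
  rewrite mulrAC mulr_natr -sumr_const; apply: ler_sum => s.
  by rewrite inE => /ltW.
have [b_gt0|] := ltP 0 b; first by rewrite ler_pM2r in ZE.
move=> b_le0; have {}b0 : b = 0 by apply/le_anti; rewrite b_le0 b0.
suff -> : Z = finset.set0 by rewrite cards0 mulr0.
apply/setP => s; rewrite !inE b0 mulr0; apply/negbTE; rewrite -leNgt.
apply: le_trans b_le0; rewrite /b big_mkcond [leRHS]big_mkcond /=; apply: ler_sum => w _.
by case: (B w) => //=; case: ifP.
Qed.

Lemma iterated_growth (h : nat -> nat -> nat) :
    (forall n i, 2 ^ i.+1 * h n i <= h n.+1 i)%N ->
  forall n k i, (2 ^ (i.+1 * k) * h n i <= h (n + k) i)%N.
Proof.
move=> hh n k i; elim: k => [|k IH]; first by rewrite muln0 mul1n addn0.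
rewrite addnS mulnS expnD -mulnA; apply: leq_trans (hh _ _).
by rewrite leq_mul2l IH orbT.
Qed.

Lemma sum_inv_pow2 (R : realType) (M K : nat) :
  \sum_(M <= k < K) (2%:R ^- k.+1 : R) <= 2%:R ^- M.
Proof.
have [KM|MK] := leqP K M; first by rewrite big_geq ?invr_ge0 ?exprn_ge0.
suff -> : \sum_(M <= k < K) (2%:R ^- k.+1 : R) = 2%:R ^- M - 2%:R ^- K.
  by rewrite gerBl invr_ge0 exprn_ge0.
have stepE k : (2%:R ^- k.+1 : R) = (- 2%:R ^- k.+1) - (- 2%:R ^- k).
  by rewrite exprS invfM; field; rewrite expf_neq0 ?pnatr_eq0.
under eq_bigr do rewrite stepE.
rewrite (telescope_sumr (fun k => - 2%:R ^- k)) 1?ltnW//; ring.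
Qed.

(** * Finite patterns and the slaloms approximating them *)

Section Patterns.
Variable f : nat -> nat.

Definition pattern (L : nat) : finType :=
  {dffun forall i : 'I_L, {set (f i).-tuple bool}}.

(** Padding to a slalom lets patterns of different lengths be compared
    coordinatewise, without casts between the dependent types of their entries. *)
Definition extend L (w : pattern L) : slalom f := fun i =>
  if (i < L)%N =P true is ReflectT iL then w (Ordinal iL) else finset.set0.

Definition truncate L (psi : slalom f) : pattern L :=
  finfun (fun i : 'I_L => psi i).

Lemma truncateK L psi i : (i < L)%N -> extend (truncate L psi) i = psi i.
Proof. by rewrite /extend => iL; case: eqP => // e; rewrite ffunE. Qed.

End Patterns.

Section Approximation.
Variables (R : realType) (f : nat -> nat) (h : nat -> nat -> nat).
Hypothesis hfh : admissible f h.
Implicit Types (n m L : nat).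

Definition bounded n L (w : pattern f L) : bool :=
  [forall i : 'I_L, (#|extend w i| <= h n i)%N && (#|extend w i| < 2 ^ gap f i)%N].

(** The event that the random pattern respects the bound [h n] and begins
    with [u]; the approximations below condition on it. *)
Definition cell n L M (u : pattern f M) : pred (pattern f L) :=
  fun w => bounded n w && (truncate M (extend w) == u).

(** The factor [m.+1] in the exponent makes the thresholds sum to at most
    [2 ^ -m], while [m.+1] steps of the growth of [h] still absorb it. *)
Definition threshold m i : R := 2%:R ^- (i.+1 * m.+1).

Definition approximation n m (u : pattern f (n + m.+1)) L
    (nu : pattern f L -> R) : slalom f := fun i =>
  if (i < n + m.+1)%N then extend u i else
  [set s | threshold m i * (\sum_(w | cell n u w) nu w) <
           \sum_(w | cell n u w && (s \in extend w i)) nu w]%SET.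

Lemma boundedP n L (w : pattern f L) i : bounded n w -> (i < L)%N ->
  (#|extend w i| <= h n i)%N /\ (#|extend w i| < 2 ^ gap f i)%N.
Proof. by move=> /forallP H iL; have /andP[] := H (Ordinal iL). Qed.

Lemma approximation_bounded n m (u : pattern f (n + m.+1)) L nu i :
    (forall w, 0 <= nu w) -> bounded n u -> (i < L)%N ->
  let S := @approximation n m u L nu i in
  (#|S| <= h (n + m.+1) i)%N /\ (#|S| < 2 ^ gap f i)%N.
Proof.
case: hfh => _ _ _ growth small nu0 ub iL; rewrite /= /approximation.
case: ltnP => [iM|Mi].
  have [uh ugap] := boundedP ub iM; split=> //; apply: leq_trans uh _.
  apply: leq_trans (iterated_growth growth n m.+1 i).
  by rewrite leq_pmull// expn_gt0.
set S := finset _.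
suff Sh : (#|S| <= h (n + m.+1) i)%N by split=> //; exact: leq_ltn_trans (small _ _ Mi).
apply: leq_trans (iterated_growth growth n m.+1 i).
have e0 : 0 < threshold m i by rewrite invr_gt0 exprn_gt0.
have wb (w : pattern f L) : cell n u w -> (#|extend w i| <= h n i)%N.
  by move=> /andP[wb _]; have [] := boundedP wb iL.
have := markov_selection nu0 wb e0.
by rewrite mulrC ler_pdivrMr ?exprn_gt0// -natrX -natrM ler_nat mulnC.
Qed.

Lemma sum_threshold m K M : \sum_(M <= k < K) threshold m k <= 2%:R ^- m.
Proof.
apply: le_trans (_ : 2%:R ^- m * 2%:R ^- M <= _); last first.
  by rewrite ler_piMr ?invr_ge0 ?exprn_ge0// invf_le1 ?exprn_gt0// exprn_ege1 ?ler1n.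
apply: le_trans (_ : 2%:R ^- m * \sum_(M <= k < K) 2%:R ^- k.+1 <= _); last first.
  by rewrite ler_wpM2l ?invr_ge0 ?exprn_ge0// sum_inv_pow2.
rewrite mulr_sumr; apply: ler_sum => k _.
rewrite -invfM -exprD lef_pV2 ?posrE ?exprn_gt0// ler_eXn2l ?ltr1n//.
by rewrite mulnS addnC leq_add2l leq_pmull.
Qed.

(** A union bound.  A pattern in [W] captures the target attached to its own
    initial segment [u], at a coordinate [k] where the approximation rejected
    it.  Rejection means that within the cell of [u] such a capture has
    probability at most [threshold m k]; the cells are disjoint, so averaging
    over [u] leaves the sum of the thresholds. *)
Lemma capture_bound n m L (nu : pattern f L -> R) (K : nat)
    (target : pattern f (n + m.+1) -> seq bool) (W : {set pattern f L}) :
    (forall w, 0 <= nu w) -> \sum_w nu w <= 1 ->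
    (forall w, w \in W -> let u := truncate (n + m.+1) (extend w) in
      bounded n w /\ exists2 k, (n + m.+1 <= k < K)%N &
        exists v : (f k).-tuple bool, [/\ tval v = take (f k) (target u),
          v \in extend w k & v \notin approximation u nu k]) ->
  \sum_(w in W) nu w <= 2%:R ^- m.
Proof.
move=> nu0 nu1 HW; set M := (n + m.+1)%N in target HW *.
pose hit u k (w : pattern f L) := [exists v : (f k).-tuple bool,
  [&& tval v == take (f k) (target u), v \in extend w k &
      v \notin approximation u nu k]].
have hitW u k : (M <= k)%N ->
    \sum_(w | cell n u w && hit u k w) nu w <=
    threshold m k * (\sum_(w | cell n u w) nu w).
  move=> Mk; have [/existsP[v /andP[/eqP vt vS]]|none] := boolP [exists v : (f k).-tuple bool,
    (tval v == take (f k) (target u)) && (v \notin approximation u nu k)].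
    move: vS; rewrite /approximation ltnNge Mk inE -leNgt; apply: le_trans.
    rewrite big_mkcond [leRHS]big_mkcond; apply: ler_sum => w _ /=.
    case: (cell n u w) => //=; case: ifP => [/existsP[v' /and3P[/eqP v't wv _]]|].
      by rewrite (_ : v = v') ?wv//; apply: val_inj; rewrite /= vt v't.
    by case: ifP.
  (* The truncated target has the wrong length, or it is not rejected at [k]. *)
  rewrite big_pred0 => [|w]; last first.
    apply/negbTE; apply: contra none => /andP[_ /existsP[v /and3P[vt _ vS]]].
    by apply/existsP; exists v; rewrite vt.
  by rewrite mulr_ge0 ?invr_ge0 ?exprn_ge0 ?sumr_ge0.
apply: le_trans (_ : \sum_u \sum_(M <= k < K) \sum_(w | cell n u w && hit u k w) nu w <= _).
  rewrite big_mkcond /=.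
  rewrite (partition_big (fun w => truncate M (extend w)) predT)//=.
  apply: ler_sum => u _; under [leRHS]eq_bigr do rewrite big_mkcond /=.
  rewrite exchange_big /= big_mkcond /=; apply: ler_sum => w _.
  have [tw|_] := eqVneq (truncate M (extend w)) u; last first.
    by apply: sumr_ge0 => k _; case: ifP.
  have [/HW [wb [k Mk [v [vt vw vS]]]]|_] := ifPn; last first.
    by apply: sumr_ge0 => k _; case: ifP.
  rewrite (bigD1_seq k) ?mem_index_iota ?iota_uniq//=.
  rewrite /cell wb tw eqxx /= (_ : hit u k w) ?lerDl.
    by apply: sumr_ge0 => ? _; case: ifP.
  by apply/existsP; exists v; rewrite -tw vt eqxx vw.
apply: le_trans (_ : \sum_u \sum_(M <= k < K)
    threshold m k * (\sum_(w | cell n u w) nu w) <= _).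
  apply: ler_sum => u _; rewrite big_nat [leRHS]big_nat.
  by apply: ler_sum => k /andP[Mk _]; exact: hitW.
under eq_bigr do rewrite -mulr_suml.
rewrite -mulr_sumr; apply: le_trans (sum_threshold m K M).
rewrite ler_piMr//; first by apply: sumr_ge0 => k _; rewrite invr_ge0 exprn_ge0.
apply: le_trans nu1.
rewrite [leRHS](partition_big (fun w => truncate M (extend w)) predT)//=.
apply: ler_sum => u _; rewrite big_mkcond [leRHS]big_mkcond /=.
by apply: ler_sum => w _; rewrite /cell; case: (bounded n w) => //=; case: ifP.
Qed.

(** Compactness: each coordinate of an approximation takes finitely many
    values, so an ultrafilter on the lengths [L] selects one of them, and the
    finitely many selections with [k < K], for all [u], are realized by a common
    large [L]. *)
Lemma approximation_limit (nu : forall L, pattern f L -> R) :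
  exists psi : forall n m, pattern f (n + m.+1) -> slalom f,
    forall n m K, exists2 L, (K <= L)%N &
      forall u k, (k < K)%N -> psi n m u k = approximation u (nu L) k.
Proof.
have [F [FU F_oo]] := ultraFilterLemma eventually_filter.
pose lim n m (u : pattern f (n + m.+1)) k :=
  cid (ultrafilter_limit (fun L => approximation u (nu L) k) FU).
exists (fun n m u k => sval (lim n m u k)) => n m K.
have : F [set L | (K <= L)%N /\ forall (u : pattern f (n + m.+1)) (k : 'I_K),
    approximation u (nu L) k = sval (lim n m u k)]%classic.
  apply: filterI; first by apply: F_oo; exists K.
  apply: filter_forall => u; apply: filter_forall => k.
  exact: (svalP (lim n m u k)).
move=> /filter_ex[L [KL HL]]; exists L => // u k kK.
by rewrite -(HL u (Ordinal kK)).
Qed.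

End Approximation.

(** * Patterns decided by conditions *)

Section Forcing.
Variables (f : nat -> nat) (h : nat -> nat -> nat).
Variables (d : Order.disp_t) (A : ctbDistrLatticeType d).
Variable tau : name (nonzero A).
Hypothesis tau_SfG : forced (fSfG f h tau).
Implicit Types (p q r : nonzero A) (L : nat).

Lemma fgraph_at_mono i (S : {set (f i).-tuple bool}) p q :
  (q <= p)%O -> fgraph_at tau S p -> fgraph_at tau S q.
Proof.
rewrite /fgraph_at /fmem; case: tau => T u c qp H r rq.
by apply: H; exact: le_trans rq qp.
Qed.

Lemma fgraph_at_dense i p :
  exists2 r, (r <= p)%O & exists S : {set (f i).-tuple bool}, fgraph_at tau S r.
Proof. by have [[_ [H _]] _] := tau_SfG p; exact: H (lexx p). Qed.

Lemma fgraph_at_unique i (S S' : {set (f i).-tuple bool}) p :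
  fgraph_at tau S p -> fgraph_at tau S' p -> S = S'.
Proof.
by move=> H H'; have [[_ [_ uniq]] _] := tau_SfG p; exact: (uniq i S S' p (lexx p)).
Qed.

Lemma fgraph_at_gap i (S : {set (f i).-tuple bool}) p :
  fgraph_at tau S p -> (#|S| < 2 ^ gap f i)%N.
Proof.
by move=> H; have [_ [_ /(_ i S p (lexx p))]] := tau_SfG p; apply.
Qed.

Definition decides L (w : pattern f L) r : Prop :=
  forall i, (i < L)%N -> fgraph_at tau (extend w i) r.

Lemma decides_dense L p : exists2 r, (r <= p)%O & exists w : pattern f L, decides w r.
Proof.
suff [r rp H] : exists2 r, (r <= p)%O &
    forall i, (i < L)%N -> exists S : {set (f i).-tuple bool}, fgraph_at tau S r.
  have Hx i : exists S : {set (f i).-tuple bool}, (i < L)%N -> fgraph_at tau S r.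
    by have [/H[S HS]|_] := ltnP i L; [exists S | exists finset.set0].
  exists r => //; exists (truncate L (fun i => sval (cid (Hx i)))) => i iL.
  by rewrite truncateK//; exact: svalP (cid (Hx i)) iL.
elim: L => [|L [r rp H]]; first by exists p.
have [s sr [S HS]] := fgraph_at_dense L r.
exists s => [|i]; first exact: le_trans sr rp.
rewrite ltnS leq_eqVlt => /orP[/eqP->|/H[S' HS']]; first by exists S.
by exists S'; exact: fgraph_at_mono HS'.
Qed.

Lemma le_nonzero p q : (p <= q)%O = (val p <= val q)%O.
Proof. by []. Qed.

Definition condition (a : A) (a0 : a != \bot%O) : nonzero A := exist _ a a0.

(** Being allowed by a condition is defined by a stronger condition that
    decides the whole pattern, as the algebra need not contain the Boolean value
    of that event. *)
Definition possible L (a : A) : {set pattern f L} :=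
  [set w | `[< exists2 r, (val r <= a)%O & decides w r >]]%SET.

Lemma possibleP L a (w : pattern f L) :
  reflect (exists2 r, (val r <= a)%O & decides w r) (w \in possible L a).
Proof. by rewrite inE; exact: asboolP. Qed.

Lemma possible_mono L a b : (a <= b)%O -> possible L a \subset possible L b.
Proof.
move=> ab; apply/fintype.subsetP => w /possibleP[r ra rw]; apply/possibleP.
by exists r => //; exact: le_trans ra ab.
Qed.

(** A nonzero element below a join meets one of the two joinands in a nonzero
    element. *)
Lemma possible_join L a b :
  possible L (a `|` b)%O \subset (possible L a :|: possible L b)%SET.
Proof.
apply/fintype.subsetP => w /possibleP[r rab rw]; rewrite finset.in_setU.
have restrict c : (val r `&` c)%O != \bot%O -> w \in possible L c.
  move=> rc; apply/possibleP; exists (condition rc); first exact: leIr.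
  by move=> i iL; apply: fgraph_at_mono (rw i iL); rewrite le_nonzero; exact: leIl.
have [ra|/restrict->//] := eqVneq (val r `&` a)%O \bot%O.
have [rb|/restrict->//] := eqVneq (val r `&` b)%O \bot%O; last by rewrite orbT.
case/negP: (valP r); apply/eqP.
by rewrite -(meet_l rab) meetUr ra rb joinx0.
Qed.

Lemma possible_null L a : possible L a = finset.set0 <-> a = \bot%O.
Proof.
split=> [H|->].
  apply: contrapT => /eqP a0.
  have [r ra [w rw]] := decides_dense L (condition a0).
  suff : w \in possible L a by rewrite H inE.
  by apply/possibleP; exists r => //; rewrite le_nonzero in ra.
apply/setP => w; rewrite [RHS]inE; apply/negP => /possibleP[r r0 _].
by have := valP r; rewrite -lex0 r0.
Qed.

End Forcing.

(** * The countable family of bounding slaloms *)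

Theorem theorem5p8 (R : realType) (f : nat -> nat) (h : nat -> nat -> nat)
    (hfh : admissible f h)
    (d : Order.disp_t) (A : ctbDistrLatticeType d) (mu : A -> R)
    (hmu : strictly_positive_fam mu) :
  good f h (nonzero A).
Proof.
move=> tau tau_SfG.
have nuP L := fam_transfer hmu (@possible_mono f d A tau L)
  (@possible_join f d A tau L) (possible_null tau_SfG L).
pose nu L := sval (cid (nuP L)).
have nu0 L w : 0 <= nu L w by rewrite /nu; case: cid => ? [].
have nu1 L : \sum_w nu L w <= 1 by rewrite /nu; case: cid => ? [].
have nu_mu L a : mu a <= \sum_(w in possible f tau L a) nu L w.
  by rewrite /nu; case: cid => ? [].
have [psi psiP] := approximation_limit h nu.
pose empty : slalom f := fun=> finset.set0.
pose H := ([set phi | SfG h phi] `&`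
  (\bigcup_n \bigcup_m range (@psi n m) `|` [set empty]))%classic.
have empty_SfG : SfG h empty.
  by split=> [|i]; [exists 0%N => i|]; rewrite cards0 // expn_gt0.
have f_ge k : (k <= f k)%N.
  case: hfh => f_incr *; elim: k => // k IH.
  exact: leq_ltn_trans IH (f_incr _ _ (ltnSn k)).
exists H; split.
- by exists empty; split => //; right.
- apply: sub_countable (subset_card_le (@subIsetr _ _ _)) _.
  rewrite -(bigcup2E (\bigcup_n \bigcup_m range (@psi n m)) [set empty])%classic.
  apply: bigcup_countable => // i _; rewrite /bigcup2; case: ifP => _.
    apply: bigcup_countable => // n _; apply: bigcup_countable => // m _.
    exact: sub_countable (card_image_le _ _) (countableP _).
  case: ifP => _; [exact: countable1 | exact: countable0].
- by move=> phi [].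
move=> [t sigma] _ Hx p q qp q_sq.
have [_ [q_bound _]] := tau_SfG q.
have [q1 q1q [n q1n]] := q_bound q (lexx q).
have [q2 q2q1 [N q2N]] := q_sq q1 q1q.
pose a := val q2.
have mua : 0 < mu a.
  rewrite lt_neqAle (fam_ge0 hmu) andbT eq_sym; apply/eqP.
  by case: hmu => _ _ _ /(_ a)[a0 _] /a0 /eqP; apply/negP/(valP q2).
have [m ma] : exists m, 2%:R ^- m < mu a.
  exists (Num.bound (mu a)^-1); rewrite invf_plt ?posrE ?exprn_gt0//.
  exact: upper_nthrootP.
have psi_SfG u : bounded h n u -> SfG h (psi n m u).
  move=> ub; split=> [|i].
    exists (n + m.+1)%N => i.
    have [L iL ->//] := psiP n m i.+1; exact: (approximation_bounded hfh (nu0 L) ub iL).1.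
  have [L iL ->//] := psiP n m i.+1; exact: (approximation_bounded hfh (nu0 L) ub iL).2.
(* The slalom [psi n m u] lies in [H], so [x] escapes it beyond [N]. *)
have miss u : exists l, bounded h n u -> [/\ (N <= l)%N, prefix t (sigma l) &
    forall k, (size t < f k <= size (sigma l))%N ->
      ~ seq_in (take (f k) (sigma l)) (psi n m u k)].
  have [ub|] := boolP (bounded h n u); last by exists 0%N.
  apply: contrapT => /forallNP no.
  apply: (Hx (psi n m u)).
    by split; [exact: psi_SfG | left; exists n => //; exists m => //; exists u].
  exists N => l Nl tl; apply: contrapT => nk; apply: (no l) => _; split=> // k tk sk.
  by apply: nk; exists k.
pose l u := sval (cid (miss u)).
have lP u := svalP (cid (miss u)); rewrite -/(l _) in lP.
(* As [k <= f k], every coordinate at which some [sigma (l u)] can be captured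
   is below [K]. *)
pose K := (maxn (n + m.+1) (\max_u (size (sigma (l u))).+1))%N.
have [L KL psiL] := psiP n m K.
have ML : (n + m.+1 <= L)%N by apply: leq_trans KL; exact: leq_maxl.
suff : mu a <= 2%:R ^- m by rewrite leNgt ma.
apply: le_trans (nu_mu L a) _.
apply: (@capture_bound R f h n m L (nu L) K (fun u => sigma (l u))) => // w.
move=> /possibleP[r ra rw] u; rewrite -/u.
have rq2 : (r <= q2)%O by rewrite le_nonzero.
have wb : bounded h n w.
  apply/forallP => i; rewrite (fgraph_at_gap tau_SfG (rw i (ltn_ord i))) andbT.
  by apply: (q1n i _ r) (rw i (ltn_ord i)); exact: le_trans rq2 q2q1.
have uw i : (i < n + m.+1)%N -> extend u i = extend w i by exact: truncateK.
have ub : bounded h n u.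
  apply/forallP => i; rewrite uw//.
  by apply/andP; apply: boundedP wb _; exact: leq_trans ML.
split=> //.
have [Nl tl no] := lP u ub.
have := q2N (l u) q2 (lexx _) Nl q2 (lexx _) tl r rq2.
move=> [r' r'r [k [tk]]] /(_ r' (lexx _)) [r'' r''r' [S [HS [v vS vt]]]].
have kK : (k < K)%N.
  case/andP: tk => _ fk; rewrite /K leq_max; apply/orP; right.
  apply: leq_trans (leq_bigmax u); rewrite ltnS; exact: leq_trans (f_ge k) fk.
have Sw : S = extend w k.
  apply: (fgraph_at_unique tau_SfG HS).
  apply: fgraph_at_mono (rw k (leq_trans kK KL)); exact: le_trans r''r' r'r.
have vpsi : v \notin psi n m u k by apply/negP => vpsi; apply: (no k tk); exists v.
exists k; last by exists v; rewrite -Sw -psiL.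
(* Below [n + m + 1] the slalom [psi n m u] agrees with [u], hence with [w]. *)
rewrite kK andbT leqNgt; apply/negP => kM; case/negP: vpsi.
by rewrite psiL// /approximation kM uw// -Sw.
Qed.
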